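(* There exists a set $M\subset \mathbb{R}^2$ which can be written as $M = \bigcup_{k=1}^{\infty} B_k$, where each $B_k$ has the following properties: (i) $B_k$ is a compact subset of a Lipschitz hypersurface $L_k\subset\mathbb{R}^2$; (ii) the orthogonal projection of $B_k$ onto each $1$-dimensional hyperplane (i.e. each line) $H \subset \mathbb{R}^2$ is nowhere dense in $H$; (iii) for each $c \in \mathbb{R}^2 \setminus B_k$, the set $\left\{\frac{x-c}{\|x-c\|}:\ x \in B_k\right\}$ is nowhere dense in the unit sphere $S_{\mathbb{R}^2}$; but such that $M \notin \mathcal{D}_l^2$.
   Context: A function $f:\mathbb{R}^2\to\mathbb{R}$ is called linearly continuous if its restriction to every (affine) line in $\mathbb{R}^2$ is continuous. $D(f)$ denotes the set of all points of discontinuity of $f$ (with respect to the usual topology of $\mathbb{R}^2$), and $\mathcal{D}_l^2:=\{D(f): f \text{ is a linearly continuous function on } \mathbb{R}^2\}$. A set $A\subset X$ in a Banach space $X$ (here $X=\mathbb{R}^2$ with the Euclidean norm $\|\cdot\|$) is called a Lipschitz hypersurface if there exist a $1$-dimensional linear space $V\subset X$, a topological complement $Y$ of $V$ in $X$, and a Lipschitz mapping $\varphi: Y\to V$ such that $A=\{y+\varphi(y): y\in Y\}$. $S_{\mathbb{R}^2}=\{x\in\mathbb{R}^2:\|x\|=1\}$. *)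

(* Defs.v *)
From HB Require Import structures.
From mathcomp Require Import all_boot all_order all_algebra.
From mathcomp Require Import all_classical all_reals all_analysis.

Set Implicit Arguments.
Unset Strict Implicit.
Unset Printing Implicit Defensive.

Import Order.TTheory GRing.Theory Num.Theory.
Import numFieldNormedType.Exports.

Local Open Scope classical_set_scope.
Local Open Scope ring_scope.

(* The plane is 'rV[R]_2 with the library's (product) topology. The library's
   norm `|x| on 'rV[R]_2 is the sup norm, hence the Euclidean norm below. *)

Definition dot (R : realType) (u v : 'rV[R]_2) : R :=
  \sum_(i < 2) u ord0 i * v ord0 i.

Definition enorm (R : realType) (u : 'rV[R]_2) : R := Num.sqrt (dot u u).

Definition unit_sphere (R : realType) : set 'rV[R]_2 := [set x | enorm x = 1].

(* An affine line whenever v != 0. *)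
Definition line (R : realType) (a v : 'rV[R]_2) : set 'rV[R]_2 :=
  [set a + t *: v | t in [set: R]].

Definition linearly_continuous (R : realType) (f : 'rV[R]_2 -> R) : Prop :=
  forall a v : 'rV[R]_2, v != 0 -> {within line a v, continuous f}.

Definition discontinuity_set (R : realType) (f : 'rV[R]_2 -> R) :
  set 'rV[R]_2 := [set x | ~ {for x, continuous f}].

Definition Dl2 (R : realType) : set (set 'rV[R]_2) :=
  [set discontinuity_set f | f in @linearly_continuous R].

(* daddv_pi V Y is the projection onto V along Y when V and Y are in direct
   sum. Its continuity is automatic in finite dimension; it is what
   distinguishes topological complements from algebraic ones. *)
Definition topological_complement (R : realType) (V Y : {vspace 'rV[R]_2}) :
  Prop :=
  [/\ (V :&: Y = 0)%VS, (V + Y = fullv)%VS &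
      continuous (daddv_pi V Y : 'rV[R]_2 -> 'rV[R]_2)].

(* A Lipschitz mapping Y -> V is given by a function on the whole plane of
   which only the values on Y matter. *)
Definition lipschitz_hypersurface (R : realType) (A : set 'rV[R]_2) : Prop :=
  exists (V Y : {vspace 'rV[R]_2}) (phi : 'rV[R]_2 -> 'rV[R]_2),
    [/\ \dim V = 1%N,
        topological_complement V Y,
        {in Y, forall y, phi y \in V},
        exists K : R,
          {in Y &, forall y z, enorm (phi y - phi z) <= K * enorm (y - z)} &
        A = [set y + phi y | y in [set` Y]]].

Definition nowhere_dense (T : topologicalType) (A : set T) : Prop :=
  interior (closure A) = set0.

(* For A `<=` H. In the type subspace H, the set H is clopen and carries its
   relative topology, and the points outside H are isolated. *)
Definition nowhere_dense_in (T : topologicalType) (H A : set T) : Prop :=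
  @nowhere_dense (subspace H) A.

(* Orthogonal projection onto line a v, for v != 0. *)
Definition orth_proj (R : realType) (a v x : 'rV[R]_2) : 'rV[R]_2 :=
  a + (dot (x - a) v / dot v v) *: v.

(* The unit vector pointing from c to x, for x != c. *)
Definition direction (R : realType) (c x : 'rV[R]_2) : 'rV[R]_2 :=
  (enorm (x - c))^-1 *: (x - c).

(* Main.v *)
(* One compact set B serves as every B_k. For a sequence s_k in [0, 1) whose
   tails are all dense in [0, 1], B consists of the points
   sum_k a_k 4^-k (1, s_k) with digits a_k in {0, 1}. The first coordinates
   determine a point in a Lipschitz way, so B lies on a Lipschitz graph, and B
   is covered by 2^N sets of diameter O(4^-N), so its Lipschitz images are
   nowhere dense in lines and in the circle. But two points of B differing in
   the single digit k span a segment of slope s_k, so the slopes within any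
   portion of B are dense in [0, 1].

   Let f be linearly continuous with D(f) = B. For x in B, the Baire theorem in
   the slope provides an open set of slopes and a length such that f is close to
   f(x) on the resulting truncated cone with vertex x. Only countably many
   choices matter, so by the Baire theorem in B the same cone and the same lower
   bound on the oscillation of f serve for a set of vertices x that is dense in
   some portion of B. That portion has two such vertices x, y with y in the
   interior of the cone at x, so f oscillates little near y, a contradiction. *)
Require Import Defs.
From HB Require Import structures.
From mathcomp Require Import all_boot all_order all_algebra.
From mathcomp Require Import all_classical all_reals all_analysis.
From mathcomp Require Import ring lra.
Import Order.TTheory GRing.Theory Num.Theory.
Import numFieldNormedType.Exports.
Local Open Scope classical_set_scope.
Local Open Scope ring_scope.
Set Implicit Arguments.
Unset Strict Implicit.
Unset Printing Implicit Defensive.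

(** * Base-4 series with coefficients in [-1, 1] *)

Section base4.
Context {R : realType}.
Implicit Types w : nat -> R.

Definition base4_sum w : R := limn (series (fun k => w k / 4 ^+ k)).

Lemma is_cvg_base4 w : (forall k, `|w k| <= 1) ->
  cvgn (series (fun k => w k / 4 ^+ k)).
Proof.
move=> w1; apply: normed_cvg; apply: (@series_le_cvg _ _ (geometric 1 4^-1)).
- by move=> k; exact: normr_ge0.
- by move=> k; rewrite geometric_ge0// invr_ge0.
- move=> k /=; rewrite mul1r normrM -exprVn.
  rewrite [`|4^-1 ^+ k|]ger0_norm ?exprn_ge0 ?invr_ge0//.
  by rewrite ler_piMl// exprn_ge0 ?invr_ge0.
- apply: is_cvg_geometric_series; rewrite ger0_norm ?invr_ge0//.
  by rewrite invf_lt1// ltr1n.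
Qed.

Lemma base4_tail w N : (forall k, `|w k| <= 1) ->
  `|base4_sum w - \sum_(k < N) w k / 4 ^+ k| <= 2 / 4 ^+ N.
Proof.
move=> w1; have cw := is_cvg_base4 w1.
(* The bound telescopes: one more term costs at most 4^-n, and 4^-n <= 2/4^n - 2/4^(n+1). *)
have partial n : (N <= n)%N ->
    `|series (fun k => w k / 4 ^+ k) n - \sum_(k < N) w k / 4 ^+ k|
      <= 2 / 4 ^+ N - 2 / 4 ^+ n.
  elim: n => [|n ih].
    by rewrite leqn0 => /eqP ->; rewrite seriesEord/= !big_ord0 !(subrr, normr0).
  rewrite leq_eqVlt => /orP[/eqP ->|].
    by rewrite seriesEord/= !(subrr, normr0).
  rewrite ltnS => /ih {}ih; rewrite seriesEord/= big_ord_recr/=.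
  rewrite seriesEord/= in ih; rewrite addrAC.
  apply: (le_trans (ler_normD _ _)).
  have p0 : 0 < (4 ^+ n : R)^-1 by rewrite invr_gt0 exprn_gt0.
  have : `|w n / 4 ^+ n| <= (4 ^+ n)^-1.
    by rewrite normrM [`|_^-1|]gtr0_norm// ler_piMl// ltW.
  rewrite exprS invfM; lra.
have cvgn_abs : (fun n => `|series (fun k => w k / 4 ^+ k) n
    - \sum_(k < N) w k / 4 ^+ k|) @ \oo
    --> `|base4_sum w - \sum_(k < N) w k / 4 ^+ k|.
  by apply: cvg_norm; apply: cvgB => //; exact: cvg_cst.
rewrite -(cvg_lim _ cvgn_abs)//; apply: limr_le.
  by apply/cvg_ex; eexists; exact: cvgn_abs.
near=> n; apply: (le_trans (partial n _)); first by near: n; exact: nbhs_infty_ge.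
by rewrite gerBl divr_ge0// exprn_ge0.
Unshelve. all: by end_near. Qed.

Lemma base4_sumB w w' : (forall k, `|w k| <= 1) -> (forall k, `|w' k| <= 1) ->
  base4_sum w - base4_sum w' = base4_sum (fun k => w k - w' k).
Proof.
move=> /is_cvg_base4 cw /is_cvg_base4 cw'; apply/esym/cvg_lim => //.
suff -> : series (fun k => (w k - w' k) / 4 ^+ k) =
    series (fun k => w k / 4 ^+ k) - series (fun k => w' k / 4 ^+ k).
  exact: cvgB.
apply/funext => n; rewrite /series/= -[RHS]sumrB.
by apply: eq_bigr => k _; rewrite mulrBl.
Qed.

End base4.

(** * Coordinates in the plane and a pigeonhole obstruction *)

Section plane.
Context {R : realType}.
Implicit Types (u v : 'rV[R]_2).

Definition pt (a b : R) : 'rV[R]_2 := \row_i (if i == 0 then a else b).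

Lemma ptE0 a b : pt a b 0 0 = a. Proof. by rewrite mxE. Qed.
Lemma ptE1 a b : pt a b 0 1 = b. Proof. by rewrite mxE. Qed.

Lemma I2P (i : 'I_2) : i = 0 \/ i = 1.
Proof. by case: i => [[|[|//]] p]; [left|right]; exact: val_inj. Qed.

Lemma rV2P u v : u 0 0 = v 0 0 -> u 0 1 = v 0 1 -> u = v.
Proof.
by move=> h0 h1; apply/rowP => i; case: (I2P i) => ->.
Qed.

Lemma dotE u v : dot u v = u 0 0 * v 0 0 + u 0 1 * v 0 1.
Proof.
rewrite /dot big_ord_recl big_ord1; congr (_ * _ + _ * _).
all: by congr (fun_of_matrix _ _ _); exact: val_inj.
Qed.

Lemma ler_entry_norm u i : `|u 0 i| <= `|u|.
Proof.
rewrite [leRHS]/Num.Def.normr /= mx_normrE.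
by apply/bigmax_geP; right => /=; exists (0, i).
Qed.

Lemma rV2_norm_le u e : 0 <= e -> `|u 0 0| <= e -> `|u 0 1| <= e -> `|u| <= e.
Proof.
move=> e0 h0 h1; rewrite [leLHS]/Num.Def.normr/= mx_normrE.
by apply: bigmax_le => // -[i j] _ /=; rewrite (ord1 i); case: (I2P j) => ->.
Qed.

(* [gam] is a bi-Lipschitz arc: 2^N + 1 equidistant points on it cannot be
   approximated by the 2^N cylinders of depth N, whose images have diameter
   at most C / 4^N. *)
Lemma arc_not_in_closure (q : (nat -> bool) -> 'rV[R]_2) (C kap : R)
    (gam : R -> 'rV[R]_2) :
  (forall N a b, (forall k, (k < N)%N -> a k = b k) ->
    `|q a - q b| <= C / 4 ^+ N) ->
  0 < kap ->
  (forall t t', 0 <= t <= 1 -> 0 <= t' <= 1 ->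
    kap * `|t - t'| <= `|gam t - gam t'|) ->
  ~ (forall t, 0 <= t <= 1 -> closure (range q) (gam t)).
Proof.
move=> qC kap0 gamK gamcl.
(* Two sample points i/2^N and j/2^N have approximants in one cylinder. The summand 2 collects their
   two approximation errors of 4^-N each, so kap/2^N <= (C + 2)/4^N, which fails for large N. *)
have key N : kap * 2 ^+ N <= C + 2.
  have I01 (l : 'I_(2 ^ N).+1) : 0 <= (l%:R / 2 ^+ N : R) <= 1.
    rewrite divr_ge0 ?exprn_ge0//= ler_pdivrMr ?exprn_gt0// mul1r.
    by rewrite -natrX ler_nat -ltnS.
  have apx (i : 'I_(2 ^ N).+1) :
      exists a, `|gam (i%:R / 2 ^+ N) - q a| <= (4 ^+ N)^-1.
    have /gamcl := I01 i.
    have e0 : 0 < (4 ^+ N : R)^-1 by rewrite invr_gt0 exprn_gt0.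
    move=> /(_ _ (nbhsx_ballx _ _ e0)) [_ [[a _ <-]]].
    by rewrite -ball_normE/= => /ltW ?; exists a.
  have [a aP] := choice apx.
  pose w i : N.-tuple bool := [tuple a i k | k < N].
  have /injectivePn[i [j ij wij]] : ~~ injectiveb w.
    apply/negP => /injectiveP /leq_card; rewrite card_ord card_tuple card_bool.
    by rewrite ltnn.
  have {wij} : `|q (a i) - q (a j)| <= C / 4 ^+ N.
    apply: qC => k kN; move/(congr1 (fun t => tnth t (Ordinal kN))): wij.
    by rewrite !tnth_mktuple.
  have Ni := aP i; have Nj := aP j; move=> qij.
  have := gamK _ _ (I01 i) (I01 j).
  rewrite -mulrBl normrM [`|_^-1|]ger0_norm ?invr_ge0 ?exprn_ge0//.
  have : 1 <= `|i%:R - j%:R : R|.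
    have dist (m n : nat) : (m < n)%N -> 1 <= `|n%:R - m%:R : R|.
      by move=> mn; rewrite -natrB 1?ltnW// normr_nat ler1n subn_gt0.
    have {}ij : (i : nat) != j by [].
    by case: (ltngtP i j) ij => // ij _; [rewrite distrC|]; exact: dist.
  move=> d1 gd.
  have e0 : 0 < (2 ^+ N : R)^-1 by rewrite invr_gt0 exprn_gt0.
  have {}gd : kap * (2 ^+ N)^-1 <= (C + 2) / 4 ^+ N.
    apply: (@le_trans _ _ (kap * (`|i%:R - j%:R| / 2 ^+ N))).
      by rewrite ler_pM2l// ler_peMl// ltW.
    apply: (le_trans gd).
    set gi := gam _ in Ni *; set gj := gam _ in Nj *.
    have -> : gi - gj = (gi - q (a i)) + (q (a i) - q (a j)) + (q (a j) - gj).
      by rewrite !addrA !subrK.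
    rewrite distrC in Nj.
    apply: (le_trans (ler_normD _ _)).
    have := ler_normD (gi - q (a i)) (q (a i) - q (a j)); lra.
  have -> : (2 ^+ N : R) = 4 ^+ N / 2 ^+ N.
    rewrite -expr_div_n; congr (_ ^+ _); lra.
  by rewrite mulrCA mulrC -ler_pdivlMr ?exprn_gt0.
have C0 : 0 <= C + 2.
  by apply: le_trans (key 0%N); rewrite mulr_ge0 ?ltW.
have := archi_boundP (divr_ge0 C0 (ltW kap0)).
set n := Num.bound _; rewrite ltr_pdivrMr// mulrC; apply/negP; rewrite -leNgt.
apply: le_trans (key n); rewrite ler_pM2l// -natrX ler_nat.
by rewrite ltnW// ltn_expl.
Qed.

End plane.

(** * Nowhere density in lines and in the circle *)

Section nowhere_dense.
Context {R : realType}.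
Implicit Types (u v : 'rV[R]_2).

(** The one-dimensional character of lines and of the circle, in the form that lets both be treated
    at once. *)
Definition has_arcs (H : set 'rV[R]_2) :=
  forall (h : 'rV[R]_2) (e : R), H h -> 0 < e ->
  exists (kap : R) (gam : R -> 'rV[R]_2), [/\ 0 < kap,
    forall t : R, 0 <= t <= 1 -> H (gam t) /\ `|h - gam t| < e &
    forall t t' : R, 0 <= t <= 1 -> 0 <= t' <= 1 ->
      kap * `|t - t'| <= `|gam t - gam t'|].

(** Around a relative interior point of the closure, a small arc of [H] would lie in the closure,
    against [arc_not_in_closure]. *)
Lemma nowhere_dense_cantor_image (H : set 'rV[R]_2)
    (q : (nat -> bool) -> 'rV[R]_2) (C : R) :
  has_arcs H -> range q `<=` H ->
  (forall N a b, (forall k, (k < N)%N -> a k = b k) ->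
    `|q a - q b| <= C / 4 ^+ N) ->
  nowhere_dense_in H (range q).
Proof.
move=> Harc qH qC; rewrite /nowhere_dense_in /nowhere_dense -subset0 => h.
rewrite /interior/= => hcl.
(* Off [H] the singleton of [h] is open in the subspace topology, so [h] would have to belong to the
   range. *)
have Hh : H h.
  apply: contrapT => nHh.
  have hc : closure (range q : set (subspace H)) h by exact: nbhs_singleton hcl.
  have : nbhs (h : subspace H) [set h].
    case: (nbhs_subspaceP H h) => [Hh|_]; [by []|by move=> ? ->].
  by move=> /hc [z [qz /= zh]]; apply: nHh; rewrite -zh; exact: qH.
have {hcl} : within H (nbhs (h : 'rV[R]_2))
    (closure (range q : set (subspace H))).
  by move: hcl; case: (nbhs_subspaceP H h) => [_|/(_ Hh)].
move=> /nbhs_ballP[e /= e0 eh].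
have [kap [gam [kap0 gamH gamK]]] := Harc h e Hh e0.
apply: (arc_not_in_closure qC kap0 gamK) => t /gamH[Hg hg].
have : closure (range q : set (subspace H)) (gam t).
  by apply: eh => //; rewrite -ball_normE.
move=> gcl W Wg; apply: gcl.
case: (nbhs_subspaceP H (gam t)) => [_|/(_ Hg)] //.
by apply: filterS Wg => z Wz _.
Qed.

Lemma line_has_arcs a v : v != 0 -> has_arcs (line a v).
Proof.
move=> v0 h e [s _ <-] e0.
have nv : 0 < `|v| by rewrite normr_gt0.
exists (e / 2), (fun t => a + (s + t * (e / 2 / `|v|)) *: v); split.
- lra.
- move=> t /andP[t0 t1]; split; first by exists (s + t * (e / 2 / `|v|)).
  rewrite opprD addrACA subrr add0r -scalerBl opprD addrA subrr sub0r.
  rewrite scaleNr normrN.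
  rewrite normrZ normrM ger0_norm// [`|e / 2 / _|]gtr0_norm ?divr_gt0//.
  have -> : t * (e / 2 / `|v|) * `|v| = t * (e / 2) by field; rewrite gt_eqF.
  nra.
- move=> t t' _ _; rewrite opprD addrACA subrr add0r -scalerBl.
  rewrite opprD addrACA subrr add0r -mulrBl normrZ normrM.
  rewrite [`|e / 2 / _|]gtr0_norm ?divr_gt0//.
  by have -> : `|t - t'| * (e / 2 / `|v|) * `|v| = e / 2 * `|t - t'|
    by field; rewrite gt_eqF.
Qed.

(* The arc is the rational parametrization of the circle starting at [h];
   its component orthogonal to [h] separates the parameters. *)
Lemma unit_sphere_has_arcs : has_arcs (@unit_sphere R).
Proof.
move=> h e; rewrite /unit_sphere/= /enorm => h1 e0.
have {}h1 : h 0 0 ^+ 2 + h 0 1 ^+ 2 = 1.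
  have d0 : 0 <= h 0 0 ^+ 2 + h 0 1 ^+ 2 by rewrite addr_ge0// sqr_ge0.
  move: h1; rewrite dotE -!expr2 => /(congr1 (fun x => x ^+ 2)).
  by rewrite sqr_sqrtr// expr1n.
set x := h 0 0 in h1; set y := h 0 1 in h1.
have x1 : `|x| <= 1 by rewrite ler_norml; apply/andP; split; nra.
have y1 : `|y| <= 1 by rewrite ler_norml; apply/andP; split; nra.
(* The parameters r t stay in [0, 1/2], where [s] is uniformly increasing, and the arc moves away
   from [h] by at most 4 r < e. *)
pose r := Num.min (1 / 2) (e / 8).
have r0 : 0 < r by rewrite lt_min; apply/andP; split; lra.
have r12 : r <= 1 / 2 by rewrite ge_min lexx.
have re : r <= e / 8 by rewrite ge_min lexx orbT.
pose c (t : R) : R := (1 - t ^+ 2) / (1 + t ^+ 2).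
pose s (t : R) : R := (2 * t) / (1 + t ^+ 2).
have p0 (t : R) : 0 < 1 + t ^+ 2 by have := sqr_ge0 t; lra.
have cs t : c t ^+ 2 + s t ^+ 2 = 1.
  by rewrite /c /s; field; have := p0 t; rewrite expr2; lra.
exists (r / 4), (fun t => pt (c (r * t) * x - s (r * t) * y)
                             (c (r * t) * y + s (r * t) * x)).
split.
- lra.
- move=> t /andP[t0 t1]; split.
    rewrite dotE ptE0 ptE1 -!expr2.
    rewrite (_ : _ + _ = (c (r * t) ^+ 2 + s (r * t) ^+ 2) *
                         (x ^+ 2 + y ^+ 2)); last by ring.
    by rewrite cs h1 mulr1 sqrtr1.
  have rt0 : 0 <= r * t by nra.
  have rt1 : r * t <= r by nra.
  have c1 : `|1 - c (r * t)| <= 2 * r.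
    rewrite /c; move: (r * t) rt0 rt1 => z rt0 rt1.
    have -> : 1 - (1 - z ^+ 2) / (1 + z ^+ 2) = 2 * z ^+ 2 / (1 + z ^+ 2).
      by field; have := p0 z; rewrite expr2; lra.
    rewrite ger0_norm ?divr_ge0 ?(ltW (p0 _)) ?mulr_ge0 ?sqr_ge0//.
    rewrite ler_pdivrMr//; nra.
  have s1 : `|s (r * t)| <= 2 * r.
    rewrite /s; move: (r * t) rt0 rt1 => z rt0 rt1.
    rewrite ger0_norm ?divr_ge0 ?(ltW (p0 _)) ?mulr_ge0//.
    rewrite ler_pdivrMr//; have := mulr_ge0 (ltW r0) (sqr_ge0 z); nra.
  have bd (a b : R) : `|a| <= 2 * r -> `|b| <= 1 -> `|a| * `|b| <= 2 * r.
    by move=> ? ?; rewrite -[leRHS]mulr1 ler_pM.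
  apply: (@le_lt_trans _ _ (4 * r)); last by lra.
  apply: rV2_norm_le; rewrite ?mxE/= -?/x -?/y.
  + lra.
  + rewrite (_ : _ - _ = (1 - c (r * t)) * x + s (r * t) * y); last by ring.
    apply: (le_trans (ler_normD _ _)); rewrite (normrM (1 - _)) (normrM (s _)).
    have := bd _ _ c1 x1; have := bd _ _ s1 y1; lra.
  + rewrite (_ : _ - _ = (1 - c (r * t)) * y - s (r * t) * x); last by ring.
    apply: (le_trans (ler_normB _ _)); rewrite (normrM (1 - _)) (normrM (s _)).
    have := bd _ _ c1 y1; have := bd _ _ s1 x1; lra.
- move=> t t' /andP[t0 t1] /andP[t'0 t'1].
  set g := pt _ _ - pt _ _.
  have gs : g 0 1 * x - g 0 0 * y = s (r * t) - s (r * t').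
    rewrite /g !mxE/= -[RHS]mulr1 -h1; ring.
  have : `|s (r * t) - s (r * t')| <= 2 * `|g|.
    rewrite -gs; apply: (le_trans (ler_normB _ _)).
    rewrite (normrM (g 0 1)) (normrM (g 0 0)).
    have bd (a b : R) : `|a| <= `|g| -> `|b| <= 1 -> `|a| * `|b| <= `|g|.
      by move=> ? ?; rewrite -[leRHS]mulr1 ler_pM.
    have := bd _ _ (ler_entry_norm g 1) x1.
    have := bd _ _ (ler_entry_norm g 0) y1; lra.
  (* On [0, 1/2] the difference quotient of [s] is at least 2 (3/4) / (25/16) = 24/25, hence more
     than 1/2. *)
  suff : r / 2 * `|t - t'| <= `|s (r * t) - s (r * t')| by lra.
  rewrite /s.
  have -> : 2 * (r * t) / (1 + (r * t) ^+ 2) - 2 * (r * t') / (1 + (r * t') ^+ 2)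
    = 2 * r * (1 - (r * t) * (r * t')) /
      ((1 + (r * t) ^+ 2) * (1 + (r * t') ^+ 2)) * (t - t').
    field; have := p0 (r * t); have := p0 (r * t'); rewrite -?expr2.
    move=> *; apply/andP; split; lra.
  rewrite normrM ler_wpM2r//; apply: le_trans (ler_norm _).
  have a0 : 0 <= r * t <= 1/2 by nra.
  have b0 : 0 <= r * t' <= 1/2 by nra.
  move: a0 b0; set A := r * t; set B := r * t' => /andP[a0 a1] /andP[b0 b1].
  rewrite ler_pdivlMr ?mulr_gt0//.
  have hA : 1 + A ^+ 2 <= 5 / 4 by nra.
  have hB : 1 + B ^+ 2 <= 5 / 4 by nra.
  have : (1 + A ^+ 2) * (1 + B ^+ 2) <= 25/16.
    by have := p0 A; have := p0 B; nra.
  have : 3 / 4 <= 1 - A * B by nra.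
  nra.
Qed.

End nowhere_dense.

(** * The Cantor set, its Lipschitz graph and its compactness *)

Section cantor_set.
Context {R : realType}.
Implicit Types (a b : nat -> bool) (N k : nat).

(* For k + 1 in [2^j, 2^(j+1)) this runs through the multiples of 2^-j in
   [0, 1), so every tail of the sequence is dense in [0, 1]. *)
Definition slope k : R := k.+1%:R / 2 ^+ trunc_log 2 k.+1 - 1.

Lemma slope_itv k : 0 <= slope k < 1.
Proof.
have /andP[l u] := trunc_log_bounds (isT : (1 < 2)%N) (isT : (0 < k.+1)%N).
have p0 : 0 < 2 ^+ trunc_log 2 k.+1 :> R by rewrite exprn_gt0.
rewrite subr_ge0 ltrBlDr ler_pdivlMr// ltr_pdivrMr// mul1r.
by rewrite -natrX ler_nat l/= -mulr2n -natrM ltr_nat -expnS.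
Qed.

Lemma slope_norm k : `|slope k| <= 1.
Proof. by have /andP[? ?] := slope_itv k; rewrite ger0_norm// ltW. Qed.

Lemma slope_tail_dense (y r : R) N : 0 <= y < 1 -> 0 < r ->
  exists2 k, (N <= k)%N & `|slope k - y| < r.
Proof.
move=> /andP[y0 y1] r0; pose j := maxn N (Num.bound r^-1).
have p0 : 0 < 2 ^+ j :> R by rewrite exprn_gt0.
have jr : (2 ^+ j)^-1 < r.
  rewrite invf_plt ?posrE//.
  apply: (lt_le_trans (archi_boundP _)); first by rewrite invr_ge0 ltW.
  rewrite -natrX ler_nat (leq_trans (leq_maxr N _))// ltnW// ltn_expl//.
pose i := Num.truncn (y * 2 ^+ j).
have yj0 : 0 <= y * 2 ^+ j by rewrite mulr_ge0// ltW.
have /andP[il iu] : i%:R <= y * 2 ^+ j < i.+1%:R by exact: truncn_itv.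
have ij : (i < 2 ^ j)%N.
  by rewrite -(ltr_nat R) (le_lt_trans il)// natrX gtr_pMl.
have p1 : (0 < 2 ^ j)%N by rewrite expn_gt0.
(* With k + 1 = 2^j + i the slope is exactly i/2^j, within 2^-j of y; and k >= N because 2^j > j >=
   N. *)
exists (2 ^ j + i).-1.
  rewrite -ltnS prednK ?addn_gt0 ?p1//.
  rewrite (leq_trans _ (leq_addr _ _))//.
  by rewrite (leq_ltn_trans (leq_maxl N (Num.bound r^-1)))// ltn_expl.
rewrite /slope prednK ?addn_gt0 ?p1// (_ : trunc_log 2 _ = j); last first.
  by apply: trunc_log_eq => //; rewrite leq_addr/= expnS mul2n -addnn ltn_add2l.
apply: le_lt_trans jr.
have -> : (2 ^ j + i)%:R / 2 ^+ j - 1 - y = (i%:R - y * 2 ^+ j) / 2 ^+ j.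
  by rewrite natrD natrX; field; rewrite gt_eqF.
rewrite normrM [`|_^-1|]gtr0_norm ?invr_gt0// ler_piMl//.
rewrite -natr1 in iu; rewrite ler_norml; apply/andP; split; lra.
Qed.

Definition cantor_pt a : 'rV[R]_2 :=
  pt (base4_sum (fun k => (a k)%:R)) (base4_sum (fun k => (a k)%:R * slope k)).

Let digit_norm (c : bool) : `|c%:R : R| <= 1.
Proof. by case: c; rewrite ?normr1 ?normr0. Qed.

Let digit_slope_norm (c : bool) k : `|c%:R * slope k| <= 1.
Proof. by rewrite normrM mulr_ile1// slope_norm. Qed.

Let digitB_norm (c d : bool) : `|c%:R - d%:R : R| <= 1.
Proof.
by case: c; case: d; rewrite ?(subrr, subr0, sub0r, normrN, normr1, normr0).
Qed.

Let digitB_slope_norm (c d : bool) k : `|(c%:R - d%:R) * slope k| <= 1.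
Proof. by rewrite normrM mulr_ile1// slope_norm. Qed.

Lemma cantor_ptB0 a b : cantor_pt a 0 0 - cantor_pt b 0 0 =
  base4_sum (fun k => (a k)%:R - (b k)%:R).
Proof. by rewrite !ptE0 base4_sumB. Qed.

Lemma cantor_ptB1 a b : cantor_pt a 0 1 - cantor_pt b 0 1 =
  base4_sum (fun k => ((a k)%:R - (b k)%:R) * slope k).
Proof.
rewrite !ptE1 base4_sumB//; congr base4_sum.
by apply/funext => k; rewrite mulrBl.
Qed.

Lemma cantor_pt_near a b N : (forall k, (k < N)%N -> a k = b k) ->
  `|cantor_pt a - cantor_pt b| <= 2 / 4 ^+ N.
Proof.
move=> ab; have e0 : 0 <= 2 / 4 ^+ N :> R by rewrite divr_ge0 ?exprn_ge0.
apply: rV2_norm_le => //; rewrite [X in `|X|]mxE [X in _ + X]mxE.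
  rewrite cantor_ptB0; have := base4_tail N (fun k => digitB_norm (a k) (b k)).
  by rewrite big1 ?subr0// => l _; rewrite ab// subrr mul0r.
rewrite cantor_ptB1.
have := base4_tail N (fun k => digitB_slope_norm (a k) (b k) k).
by rewrite big1 ?subr0// => l _; rewrite ab// subrr !mul0r.
Qed.

(** Only the k-th of the first N terms of the difference survives. This realizes the slope [slope k]
    between two points whose digits from N on are not controlled. *)
Lemma cantor_pt_step a b N k : (k < N)%N -> a k -> ~~ b k ->
  (forall l, (l < N)%N -> l != k -> a l = b l) ->
  `|cantor_pt a - cantor_pt b - pt (4 ^- k) (slope k / 4 ^+ k)| <= 2 / 4 ^+ N.
Proof.
move=> kN ak bk ab.
have e0 : 0 <= 2 / 4 ^+ N :> R by rewrite divr_ge0 ?exprn_ge0.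
have single (w : nat -> R) : (forall l, (l < N)%N -> l != k -> w l = 0) ->
    \sum_(l < N) w l / 4 ^+ l = w k / 4 ^+ k.
  move=> w0; rewrite (bigD1 (Ordinal kN))//= big1 ?addr0// => l lk.
  by rewrite w0 ?mul0r.
have dk : (a k)%:R - (b k)%:R = 1 :> R by rewrite ak (negbTE bk) subr0.
apply: rV2_norm_le => //; rewrite [X in `|X|]mxE [X in _ + X]mxE;
  rewrite [X in X - _]mxE [X in _ + X - _]mxE.
  rewrite cantor_ptB0 ptE0.
  have := base4_tail N (fun k => digitB_norm (a k) (b k)).
  rewrite (single (fun k => (a k)%:R - (b k)%:R)) ?dk ?mul1r// => l lN lk.
  by rewrite ab// subrr.
rewrite cantor_ptB1 ptE1.
have := base4_tail N (fun k => digitB_slope_norm (a k) (b k) k).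
rewrite (single (fun k => ((a k)%:R - (b k)%:R) * slope k)) ?dk ?mul1r//.
by move=> l lN lk; rewrite ab// subrr mul0r.
Qed.

(** If m is the first digit where a and b differ, the ordinates differ by at most 2/4^m, and the
    abscissas by at least 4^-m - 2/4^(m+1) = 4^-m/2. *)
Lemma cantor_pt_lipschitz a b :
  `|cantor_pt a 0 1 - cantor_pt b 0 1|
    <= 4 * `|cantor_pt a 0 0 - cantor_pt b 0 0|.
Proof.
have [|] := pselect (forall k, a k = b k).
  by move=> /funext ->; rewrite !subrr normr0 mulr0.
move=> /existsNP[m0 /eqP m0P].
have ex : exists m, a m != b m by exists m0.
case: (ex_minnP ex) => m am mmin.
have agree k : (k < m)%N -> a k = b k.
  by move=> km; apply/eqP; apply: contraTT km => /mmin; rewrite -leqNgt.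
rewrite cantor_ptB0 cantor_ptB1.
have := base4_tail m.+1 (fun k => digitB_norm (a k) (b k)).
have := base4_tail m (fun k => digitB_slope_norm (a k) (b k) k).
rewrite big1 ?subr0; last by move=> l _; rewrite agree// subrr !mul0r.
rewrite big_ord_recr/= big1 ?add0r; last first.
  by move=> l _; rewrite agree// subrr mul0r.
have : `|((a m)%:R - (b m)%:R) / 4 ^+ m : R| = (4 ^+ m)^-1.
  rewrite normrM [`|_^-1|]ger0_norm ?invr_ge0 ?exprn_ge0//.
  case: (a m) (b m) am => -[]//= _;
    by rewrite ?subr0 ?sub0r ?normrN normr1 mul1r.
rewrite exprS invfM.
set e := (4 ^+ m)^-1; set z := (_ - _) * e; set y := base4_sum _.
set x := base4_sum _ => ze yz.
have := ler_normB x (x - z); rewrite subKr ze.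
lra.
Qed.

Lemma exp4_small (c e : R) N : 0 < e -> exists2 n, (N <= n)%N & c / 4 ^+ n < e.
Proof.
move=> e0; pose n := maxn N (Num.bound (c / e)).
exists n; first exact: leq_maxl.
rewrite ltr_pdivrMr ?exprn_gt0// mulrC -ltr_pdivrMr//.
apply: lt_le_trans (upper_nthrootP (leq_maxr N _)) _.
by apply: lerXn2r; rewrite ?nnegrE// ler_nat.
Qed.

Lemma cantor_norm a : `|cantor_pt a 0 0| <= 2 /\ `|cantor_pt a 0 1| <= 2.
Proof.
rewrite ptE0 ptE1; split.
  have := base4_tail 0 (fun k => digit_norm (a k)).
  by rewrite big_ord0 subr0 divr1.
have := base4_tail 0 (fun k => digit_slope_norm (a k) k).
by rewrite big_ord0 subr0 divr1.
Qed.

(* McShane's extension of the graph map of the Cantor set. *)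
Definition cantor_graph (t : R) : R :=
  sup (range (fun a => cantor_pt a 0 1 - 4 * `|t - cantor_pt a 0 0|)).

Let cantor_graph_has_sup t :
  has_sup (range (fun a => cantor_pt a 0 1 - 4 * `|t - cantor_pt a 0 0|)).
Proof.
split; first by eexists; exists (fun=> true).
exists 2 => _ [a _ <-]; have [_ /ler_normlP[_ ?]] := cantor_norm a.
have := normr_ge0 (t - cantor_pt a 0 0); lra.
Qed.

Lemma cantor_graphE a : cantor_graph (cantor_pt a 0 0) = cantor_pt a 0 1.
Proof.
apply/eqP; rewrite eq_le; apply/andP; split.
  apply: ge_sup; first by have [] := cantor_graph_has_sup (cantor_pt a 0 0).
  move=> _ [b _ <-]; have := cantor_pt_lipschitz b a.
  by rewrite [`|cantor_pt b 0 0 - _|]distrC => /ler_normlP[_ ?]; lra.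
apply: ub_le_sup; first by have [] := cantor_graph_has_sup (cantor_pt a 0 0).
by exists a => //; rewrite subrr normr0 mulr0 subr0.
Qed.

Lemma cantor_graph_lipschitz t t' :
  `|cantor_graph t - cantor_graph t'| <= 4 * `|t - t'|.
Proof.
have half x y : cantor_graph x - cantor_graph y <= 4 * `|x - y|.
  rewrite lerBlDr; apply: ge_sup; first by have [] := cantor_graph_has_sup x.
  move=> _ [a _ <-].
  have : cantor_pt a 0 1 - 4 * `|y - cantor_pt a 0 0| <= cantor_graph y.
    by apply: ub_le_sup; [have [] := cantor_graph_has_sup y | exists a].
  have := ler_distD x y (cantor_pt a 0 0); rewrite [`|y - x|]distrC; lra.
rewrite ler_norml half andbT; have := half t' t; rewrite distrC; lra.
Qed.

Lemma cantor_lipschitz_hypersurface :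
  exists L, lipschitz_hypersurface L /\ range cantor_pt `<=` L.
Proof.
pose e0 : 'rV[R]_2 := pt 1 0; pose e1 : 'rV[R]_2 := pt 0 1.
pose phi (y : 'rV[R]_2) : 'rV[R]_2 := cantor_graph (y 0 0) *: e1.
have e00 : e0 != 0.
  by apply/eqP => /rowP/(_ 0)/eqP; rewrite ptE0 mxE oner_eq0.
have e10 : e1 != 0.
  by apply/eqP => /rowP/(_ 1)/eqP; rewrite ptE1 mxE oner_eq0.
exists [set y + phi y | y in [set` <[e0]>%VS]]; split; last first.
  move=> _ [a _ <-]; move: (cantor_pt a) (cantor_graphE a) => u graph_u.
  exists (u 0 0 *: e0); first by rewrite /= memvZ ?memv_line.
  rewrite /phi; apply: rV2P; rewrite !mxE/=;
    by rewrite ?mulr1 ?mulr0 ?addr0 ?add0r.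
have capv : (<[e1]> :&: <[e0]> = 0)%VS.
  apply/eqP; rewrite -subv0; apply/subvP => u.
  rewrite memv_cap => /andP[/vlineP[c ->] /vlineP[d]].
  by move=> /rowP/(_ 1); rewrite !mxE/= mulr1 mulr0 => ->; rewrite scale0r mem0v.
have decomp (u : 'rV[R]_2) : u = u 0 1 *: e1 + u 0 0 *: e0.
  by apply: rV2P; rewrite !mxE/=; rewrite ?mulr1 ?mulr0 ?addr0 ?add0r.
have addv : (<[e1]> + <[e0]> = fullv)%VS.
  apply/vspaceP => u; rewrite memvf (decomp u).
  by rewrite memv_add// memvZ ?memv_line.
exists <[e1]>%VS, <[e0]>%VS, phi; split => //.
- by rewrite dim_vline e10.
- split => //.
  (* Here V is the vertical and Y the horizontal axis; the projection is a coordinate times [e1],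
     whence its continuity. *)
  have -> : (daddv_pi <[e1]> <[e0]> : 'rV[R]_2 -> 'rV[R]_2) =
      fun u => u 0 1 *: e1.
    apply/funext => u.
    rewrite [in LHS](decomp u) linearD !linearZ/= daddv_pi_id ?memv_line//.
    have := daddv_pi_add capv (_ : e0 \in _); rewrite [X in _ + X]daddv_pi_id
      ?memv_line//; last by rewrite capvC.
    rewrite addv memvf => /(_ isT) /(canRL (addrK _)) ->.
    by rewrite subrr scaler0 addr0.
  move=> u; have cu := @coord_continuous R 1 2 0 1 u; exact: cvgZr_tmp cu.
- by move=> y _; rewrite /phi memvZ ?memv_line.
- exists 4 => y z /vlineP[c ->] /vlineP[d ->].
  have -> : c *: e0 - d *: e0 = pt (c - d) 0.
    by apply: rV2P; rewrite !mxE/=; rewrite ?mulr1 ?mulr0 ?subr0.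
  have -> : phi (c *: e0) - phi (d *: e0) =
      pt 0 (cantor_graph c - cantor_graph d).
    by rewrite /phi; apply: rV2P; rewrite !mxE/=; rewrite ?mulr1 ?mulr0 ?subr0.
  rewrite /enorm !dotE !ptE0 !ptE1 !mul0r add0r addr0 -!expr2 !sqrtr_sqr.
  exact: cantor_graph_lipschitz.
Qed.

(** A continuous image of the Cantor space: fixing the first N digits gives a neighbourhood there,
    and an image of diameter at most 2/4^N. *)
Lemma compact_cantor : compact (range cantor_pt).
Proof.
have -> : range cantor_pt = cantor_pt @` [set: cantor_space] by [].
apply: continuous_compact; last exact: cantor_space_compact.
apply: continuous_subspaceT => a.
apply/cvgrPdist_lt => e e0.
have [N _ Ne] := exp4_small 2 0 e0.
have : \forall b \near a, forall i : 'I_N, (b : cantor_space) i = a i.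
  apply: (@filter_forall cantor_space 'I_N
    (fun i b => (b : cantor_space) i = a i) (nbhs a)) => i.
  exact: (@proj_continuous nat (fun=> bool : topologicalType) i a [set a i]
    (discrete_set1 _)).
apply: filterS => b ab; apply: le_lt_trans Ne; apply: cantor_pt_near => k kN.
by rewrite (ab (Ordinal kN)).
Qed.

End cantor_set.

(** * Orthogonal and radial projections of the Cantor set *)

Section projections.
Context {R : realType}.
Implicit Types (u v w c : 'rV[R]_2).

(** A cylinder of depth N has diameter at most 2/4^N, so its image under [g] has diameter at most 2
    C/4^N. *)
Lemma nowhere_dense_lipschitz_cantor (H : set 'rV[R]_2) (g : 'rV[R]_2 -> 'rV[R]_2)
    (C : R) : has_arcs H -> 0 <= C ->
  g @` range cantor_pt `<=` H ->
  (forall a b, `|g (cantor_pt a) - g (cantor_pt b)| <=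
               C * `|cantor_pt a - cantor_pt b|) ->
  nowhere_dense_in H (g @` range cantor_pt).
Proof.
move=> Harc C0; rewrite image_comp => gH gC.
apply: (@nowhere_dense_cantor_image _ _ _ (C * 2)) => // N a b ab.
apply: (le_trans (gC a b)); rewrite -mulrA.
by rewrite ler_wpM2l// cantor_pt_near.
Qed.

Lemma dot_le u v : `|dot u v| <= 2 * (`|u| * `|v|).
Proof.
rewrite dotE; apply: (le_trans (ler_normD _ _)).
rewrite (normrM (u 0 0)) (normrM (u 0 1)).
have le i : `|u 0 i| * `|v 0 i| <= `|u| * `|v| by rewrite ler_pM// ler_entry_norm.
have := le 0; have := le 1; lra.
Qed.

Lemma dot_ge0 u : 0 <= dot u u.
Proof. by rewrite dotE -!expr2 addr_ge0// sqr_ge0. Qed.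

Lemma nowhere_dense_orth_proj a v : v != 0 ->
  nowhere_dense_in (line a v) (orth_proj a v @` range cantor_pt).
Proof.
move=> v0.
have C0 : 0 <= 2 * (`|v| * `|v|) / dot v v by rewrite divr_ge0 ?dot_ge0 ?mulr_ge0.
apply: nowhere_dense_lipschitz_cantor C0 _ _; first exact: line_has_arcs.
  by move=> _ [u _ <-]; exists (dot (u - a) v / dot v v).
move=> b d; rewrite /orth_proj opprD addrACA subrr add0r -scalerBl -mulrBl.
move: (cantor_pt b) (cantor_pt d) => u w.
have -> : dot (u - a) v - dot (w - a) v = dot (u - w) v.
  by rewrite !dotE !mxE; ring.
rewrite normrZ normrM [`|_^-1|]ger0_norm ?invr_ge0 ?dot_ge0//.
have -> : 2 * (`|v| * `|v|) / dot v v * `|u - w| =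
   2 * (`|u - w| * `|v|) / dot v v * `|v| by ring.
by rewrite !ler_wpM2r ?invr_ge0 ?dot_ge0 ?dot_le.
Qed.

Lemma enorm_ge0 u : 0 <= enorm u. Proof. exact: sqrtr_ge0. Qed.

Lemma enormK u : enorm u ^+ 2 = dot u u.
Proof. by rewrite sqr_sqrtr ?dot_ge0. Qed.

Lemma enorm_entry u i : `|u 0 i| <= enorm u.
Proof.
rewrite -sqrtr_sqr ler_wsqrtr// dotE -!expr2.
by case: (I2P i) => ->; rewrite ?lerDl ?lerDr sqr_ge0.
Qed.

Lemma norm_le_enorm u : `|u| <= enorm u.
Proof. by apply: rV2_norm_le; rewrite ?enorm_ge0 ?enorm_entry. Qed.

(** Comes from dividing |u|^2 - |w|^2 = (u - w).(u + w) by |u| + |w|; the factor 2 counts the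
    coordinates, since the right side is the sup norm. *)
Lemma enorm_lipschitz u w : `|enorm u - enorm w| <= 2 * `|u - w|.
Proof.
have [|s0] := leP (enorm u + enorm w) 0.
  have := enorm_ge0 u; have := enorm_ge0 w => w0 u0 s.
  have -> : enorm u = 0 by lra.
  have -> : enorm w = 0 by lra.
  by rewrite subrr normr0 mulr_ge0.
rewrite -(ler_pM2r s0) -[X in _ * X <= _](gtr0_norm s0) -normrM -subr_sqr !enormK.
have -> : dot u u - dot w w =
    (u - w) 0 0 * (u 0 0 + w 0 0) + (u - w) 0 1 * (u 0 1 + w 0 1).
  by rewrite !dotE !mxE; ring.
apply: (le_trans (ler_normD _ _)).
rewrite (normrM ((u - w) 0 0)) (normrM ((u - w) 0 1)).
have le i : `|(u - w) 0 i| * `|u 0 i + w 0 i| <= `|u - w| * (enorm u + enorm w).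
  rewrite ler_pM// ?ler_entry_norm//.
  by rewrite (le_trans (ler_normD _ _))// lerD// enorm_entry.
have := le 0; have := le 1; lra.
Qed.

Lemma enorm_normalize u : 0 < enorm u -> enorm ((enorm u)^-1 *: u) = 1.
Proof.
move=> u0; rewrite {1}/enorm.
have -> : dot ((enorm u)^-1 *: u) ((enorm u)^-1 *: u) =
    (enorm u)^-1 ^+ 2 * dot u u.
  by rewrite !dotE !mxE; ring.
by rewrite -enormK -exprMn mulVf ?gt_eqF// expr1n sqrtr1.
Qed.

(** The difference is 1/|u| times (u - w) + (|w| - |u|) w/|w|; the two summands contribute 1 and 2
    to the constant 3. *)
Lemma normalize_lipschitz u w (d : R) : 0 < d -> d <= enorm u -> 0 < enorm w ->
  `|(enorm u)^-1 *: u - (enorm w)^-1 *: w| <= 3 / d * `|u - w|.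
Proof.
move=> d0 du w0; have u0 : 0 < enorm u by lra.
have -> : (enorm u)^-1 *: u - (enorm w)^-1 *: w =
    (enorm u)^-1 *: ((u - w) + ((enorm w - enorm u) / enorm w) *: w).
  by apply/rowP => i; rewrite !mxE; field; rewrite !gt_eqF.
rewrite normrZ gtr0_norm ?invr_gt0// mulrC ler_pdivrMr//.
apply: (@le_trans _ _ (3 * `|u - w|)).
  apply: (le_trans (ler_normD _ _)).
  rewrite normrZ normrM [`|_^-1|]gtr0_norm ?invr_gt0//.
  have : `|enorm w - enorm u| / enorm w * `|w| <= `|enorm w - enorm u|.
    by rewrite -mulrA ler_piMr// mulrC ler_pdivrMr// mul1r norm_le_enorm.
  have := enorm_lipschitz w u; rewrite [`|w - u|]distrC; lra.
have -> : 3 / d * `|u - w| * enorm u = 3 * `|u - w| * (enorm u / d) by ring.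
by rewrite ler_peMr ?mulr_ge0// ler_pdivlMr// mul1r.
Qed.

Lemma nowhere_dense_direction c : ~ range cantor_pt c ->
  nowhere_dense_in (@unit_sphere R) (direction c @` range cantor_pt).
Proof.
move=> cB.
(* By compactness [c] has a positive distance d from the Cantor set, and at distance d normalization
   is Lipschitz with constant 3/d. *)
have : open (~` range (@cantor_pt R)).
  apply: closed_openC; apply: compact_closed compact_cantor.
  exact: norm_hausdorff.
rewrite openE => /(_ _ cB) /nbhs_ballP[d /= d0 dB].
have dle a : d <= enorm (cantor_pt a - c).
  apply: le_trans (norm_le_enorm _); rewrite leNgt; apply/negP => lt.
  by apply: (dB (cantor_pt a)); [rewrite -ball_normE/= distrC | exists a].
have pos a : 0 < enorm (cantor_pt a - c) by apply: lt_le_trans (dle a).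
apply: (@nowhere_dense_lipschitz_cantor _ _ (3 / d)).
- exact: unit_sphere_has_arcs.
- by rewrite divr_ge0// ltW.
- by move=> _ [_ [a _ <-] <-]; exact: enorm_normalize.
- move=> a b; rewrite /direction.
  have -> : cantor_pt a - cantor_pt b = (cantor_pt a - c) - (cantor_pt b - c).
    by rewrite opprB addrA subrK.
  exact: normalize_lipschitz.
Qed.

End projections.

(** * The Baire theorem for digit sequences *)

(** If no [E i] were dense in a cylinder, every finite word could be extended so as to avoid a given
    [E i]; treating all indices in turn produces a sequence in none of them. *)
Lemma baire_cylinder (I : countType) (E : I -> set (nat -> bool)) :
  (forall a, exists i, E i a) ->
  exists i a N, forall b M, (forall k, (k < N)%N -> a k = b k) ->
    exists2 c, (forall k, (k < M)%N -> b k = c k) & E i c.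
Proof.
move=> Ecov; apply: contrapT => nE.
(* A pair of a sequence and a length stands for a finite word. Stage n avoids the set coded by n,
   and only lengthens the word if n codes no index. *)
have step (p : nat * ((nat -> bool) * nat)) : exists q : (nat -> bool) * nat,
    [/\ forall k, (k < p.2.2)%N -> p.2.1 k = q.1 k, (p.2.2 < q.2)%N &
      forall i c, unpickle p.1 = Some i ->
        (forall k, (k < q.2)%N -> q.1 k = c k) -> ~ E i c].
  case: p => n [a N] /=.
  case: (unpickle n) => [i|]; last by exists (a, N.+1).
  apply: contrapT => nq; apply: nE; exists i, a, N => b M ab.
  apply: contrapT => nc; apply: nq; exists (b, maxn M N.+1); split => //=.
    by rewrite leq_maxr.
  move=> _ c [<-] bc Eic; apply: nc; exists c => // k kM.
  by apply: bc; rewrite leq_max kM.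
have [g gP] := choice step.
pose st := fix st n := if n is n'.+1 then g (n', st n') else (fun=> false, 0%N).
have stN n : (n <= (st n).2)%N.
  elim: n => [//|n ih]; have [_ /= lt _] := gP (n, st n).
  exact: leq_ltn_trans lt.
have st_mono n m : (n <= m)%N -> ((st n).2 <= (st m).2)%N /\
    forall k, (k < (st n).2)%N -> (st n).1 k = (st m).1 k.
  elim: m => [|m ih]; first by rewrite leqn0 => /eqP ->.
  rewrite leq_eqVlt => /orP[/eqP -> //|]; rewrite ltnS => /ih[le eq].
  have [/= eqg ltg _] := gP (m, st m).
  split; first exact: leq_trans le (ltnW ltg).
  by move=> k kn; rewrite eq// eqg// (leq_trans kn).
(* The word at stage k + 1 has length at least k + 1, so its digit k is final. *)
pose x k := (st k.+1).1 k.
have stx n k : (k < (st n).2)%N -> (st n).1 k = x k.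
  move=> kn; have [le|lt] := leqP n k.+1.
    by have [_] := st_mono _ _ le; exact.
  by have [_ eq] := st_mono _ _ (ltnW lt); apply/esym/eq/stN.
have [i Ei] := Ecov x.
have [_ _ /= /(_ i x (pickleK i))] := gP (pickle i, st (pickle i)); apply => //.
exact: (stx (pickle i).+1).
Qed.

(** * Linearly continuous functions and the Cantor set *)

Section not_discontinuity_set.
Context {R : realType}.
Implicit Types (f : 'rV[R]_2 -> R) (x v w z : 'rV[R]_2).

Lemma line_continuous f x v : linearly_continuous f -> v != 0 ->
  continuous (fun t : R => f (x + t *: v)).
Proof.
move=> lcf v0 t; have /subspace_continuousP fc := lcf x v v0.
have xt : line x v (x + t *: v) by exists t.
apply: cvg_trans (fc _ xt) => W /= WW.
have : (fun s : R => x + s *: v) @ t --> x + t *: v.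
  by apply: cvgD; [exact: cvg_cst | apply: cvgZr_tmp; exact: cvg_id].
move=> /(_ _ WW) nW; apply: (@filterS _ (nbhs t) _ _ _ _ nW) => s; apply.
by exists s.
Qed.

(* Baire in the slope, on the lines through x. *)
Lemma slope_cone f x (e : R) : linearly_continuous f -> 0 < e ->
  exists m k0, forall s t : R,
    `|s - slope k0| <= m.+1%:R^-1 -> 0 <= t <= m.+1%:R^-1 ->
    `|f (x + t *: pt 1 s) - f x| <= e.
Proof.
move=> lcf e0.
pose T m : set R := [set t | 0 <= t <= m.+1%:R^-1].
pose A m : set R := `[0, 1] `&` \bigcap_(t in T m)
  [set s | `|f (x + t *: pt 1 s) - f x| <= e].
have closedA m : closed (A m).
  apply: closedI; first exact: itv_closed.
  apply: closed_bigI => t _.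
  (* For fixed t the point x + t (1, s) moves along a vertical line with s, or stays put if t = 0,
     so the condition on s is closed. *)
  have -> : [set s | `|f (x + t *: pt 1 s) - f x| <= e] =
     (fun s => `|f ((x + t *: pt 1 0) + s *: pt 0 t) - f x|) @^-1`
       [set y | y <= e].
    apply/seteqP; split => s /=;
      rewrite -addrA (_ : _ *: _ + _ = t *: pt 1 s)//;
      by apply: rV2P; rewrite !mxE/=; ring.
  apply: closed_comp; last exact: closed_le.
  move=> s _; apply: cvg_norm; apply: cvgB; last exact: cvg_cst.
  have [->|t0] := eqVneq t 0.
    have -> : pt 0 0 = 0 :> 'rV[R]_2 by apply: rV2P; rewrite !mxE.
    rewrite scaler0; under eq_fun do rewrite scaler0.
    exact: cvg_cst.
  apply: line_continuous => //; apply: contra_neq t0 => /rowP/(_ 1).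
  by rewrite !mxE.
(* Continuity at x along each line of slope s puts every s of ]0, 1[ into some [A m]. *)
have [m mP] : exists m, ~ dense (~` A m).
  apply: contrapT => /forallNP nd.
  have /Baire : forall m, open (~` A m) /\ dense (~` A m : set R^o).
    by move=> m; split; [exact: closed_openC | apply: contrapT; exact: nd].
  move=> /(_ `]0, 1[%classic); case.
  - by exists (1 / 2) => /=; rewrite in_itv/=; apply/andP; split; lra.
  - exact: itv_open.
  - move=> s [/=]; rewrite in_itv/= => /andP[s0 s1] sA.
    have v0 : pt 1 s != 0.
      by apply/eqP => /rowP/(_ 0)/eqP; rewrite !mxE/= oner_eq0.
    have /cvgrPdist_le/(_ e e0)/nbhs_ballP[r /= r0 rP] :=
      @line_continuous f x _ lcf v0 0.
    apply: (sA (Num.bound r^-1)) => //; split; first by rewrite /= in_itv/= !ltW.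
    move=> t /= /andP[t0 t1]; rewrite distrC.
    have := rP t; rewrite scale0r addr0; apply.
    rewrite -ball_normE/= sub0r normrN ger0_norm//; apply: (le_lt_trans t1).
    rewrite invf_plt ?posrE//.
    apply: (@lt_le_trans _ _ (Num.bound r^-1)%:R); last by rewrite ler_nat.
    by apply: archi_boundP; rewrite invr_ge0 ltW.
move/existsNP: mP => [U /not_implyP[[s Us] /not_implyP[oU UA]]].
have {}UA : U `<=` A m.
  by move=> z Uz; apply: contrapT => nz; apply: UA; exists z.
move: (oU); rewrite openE => /(_ _ Us)/nbhs_ballP[r /= r0 rU].
have s01 : 0 <= s < 1.
  have [/= + _] := UA _ Us; rewrite in_itv/= => /andP[-> _] /=.
  have /UA [/= + _] : U (s + r / 2).
    apply: rU; rewrite -ball_normE/= opprD addrA subrr sub0r normrN.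
    by rewrite gtr0_norm; lra.
  rewrite in_itv/= => /andP[_]; lra.
have r20 : 0 < r / 2 by lra.
(* Centring the cone at a term of the sequence leaves only countably many cones. *)
have [k0 _ k0s] := slope_tail_dense 0 s01 r20.
pose m' := maxn m (Num.bound (r / 2)^-1).
have m'r : m'.+1%:R^-1 < r / 2.
  rewrite invf_plt ?posrE//.
  apply: (@lt_le_trans _ _ (Num.bound (r / 2)^-1)%:R); last first.
    by rewrite ler_nat leqW// leq_maxr.
  by apply: archi_boundP; rewrite invr_ge0 ltW.
have m'm : m'.+1%:R^-1 <= m.+1%:R^-1 :> R.
  by rewrite lef_pV2 ?posrE// ler_nat ltnS leq_maxl.
exists m', k0 => s' t ss' /andP[t0 tm].
have /UA [_ ] : U s'.
  apply: rU; rewrite -ball_normE/= distrC.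
  have := ler_distD (slope k0) s' s; have := le_lt_trans ss' m'r; lra.
by apply; rewrite /T/= t0/= (le_trans tm).
Qed.

(** The point (T, sig T) is interior to the cone. The radius is written 2 rho because two errors
    below rho will be added. *)
Lemma cone_nbhs (T sig sig0 del : R) : 0 < T < del -> del <= 1 ->
  `|sig - sig0| < del -> `|sig0| <= 1 ->
  exists2 rho, 0 < rho & forall w, `|w - pt T (sig * T)| < 2 * rho ->
    exists t s, [/\ 0 <= t <= del, `|s - sig0| <= del & w = t *: pt 1 s].
Proof.
move=> /andP[T0 Td] d1 sd s1.
(* The first bound absorbs three errors of size 2 rho in the slope estimate, the second keeps the
   abscissa below del. *)
pose rho := Num.min ((del - `|sig - sig0|) * T / 6) ((del - T) / 2).
have r0 : 0 < rho.
  by rewrite lt_min; apply/andP; split; [rewrite divr_gt0// mulr_gt0//|]; lra.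
have r1 : rho <= (del - `|sig - sig0|) * T / 6 by rewrite ge_min lexx.
have r2 : rho <= (del - T) / 2 by rewrite ge_min lexx orbT.
have r3 : (del - `|sig - sig0|) * T <= T.
  rewrite ler_piMl//; first exact: ltW.
  have := normr_ge0 (sig - sig0); lra.
exists rho => // w wT.
have w0 : `|w 0 0 - T| < 2 * rho.
  by apply: le_lt_trans wT; rewrite (le_trans _ (ler_entry_norm _ 0))// !mxE.
have w1 : `|w 0 1 - sig * T| < 2 * rho.
  by apply: le_lt_trans wT; rewrite (le_trans _ (ler_entry_norm _ 1))// !mxE.
move: w0; rewrite ltr_norml => /andP[w0 w0'].
have t0 : 0 < w 0 0 by lra.
exists (w 0 0), (w 0 1 / w 0 0); split.
- by apply/andP; split; lra.
- have -> : w 0 1 / w 0 0 - sig0 = (w 0 1 - sig0 * w 0 0) / w 0 0.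
    by field; rewrite gt_eqF.
  rewrite normrM [`|_^-1|]gtr0_norm ?invr_gt0// ler_pdivrMr//.
  have -> : w 0 1 - sig0 * w 0 0 =
      (w 0 1 - sig * T) + (sig - sig0) * T - sig0 * (w 0 0 - T).
    by ring.
  apply: (le_trans (ler_normB _ _)).
  have := ler_normD (w 0 1 - sig * T) ((sig - sig0) * T).
  rewrite (normrM (sig - sig0)) (normrM sig0) (gtr0_norm T0).
  have : `|sig0| * `|w 0 0 - T| <= 2 * rho.
    rewrite -[leRHS]mul1r ler_pM// ler_norml; apply/andP; split; lra.
  have : del * (T - 2 * rho) <= del * w 0 0 by rewrite ler_pM2l; lra.
  have : del * rho <= rho by rewrite ler_piMl// ltW.
  lra.
- by apply: rV2P; rewrite !mxE/= ?mulr1// mulrCA divff ?gt_eqF// mulr1.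
Qed.

Lemma discontinuity_set_neq_cantor f : linearly_continuous f ->
  discontinuity_set f <> range cantor_pt.
Proof.
move=> lcf Df.
(* An index (n, m, k0) encodes an oscillation of at least 1/(n+1) at the point, and a cone of length
   and slope radius 1/(m+1) about [slope k0] on which f stays within a quarter of that from its
   value at the vertex. *)
pose E (i : nat * nat * nat) : set (nat -> bool) := [set a |
  (forall r : R, 0 < r -> exists2 z, `|cantor_pt a - z| < r &
    i.1.1.+1%:R^-1 <= `|f z - f (cantor_pt a)|) /\
  (forall s t : R,
    `|s - slope i.2| <= i.1.2.+1%:R^-1 -> 0 <= t <= i.1.2.+1%:R^-1 ->
    `|f (cantor_pt a + t *: pt 1 s) - f (cantor_pt a)| <= i.1.1.+1%:R^-1 / 4)].
have Ecov a : exists i, E i a.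
  have : discontinuity_set f (cantor_pt a) by rewrite Df; exists a.
  rewrite /discontinuity_set/= => /cvgrPdist_lt/existsNP[e /not_implyP[e0 ne]].
  pose n := Num.bound e^-1.
  have ne' : n.+1%:R^-1 < e.
    rewrite invf_plt ?posrE//.
    apply: (@lt_le_trans _ _ n%:R); last by rewrite ler_nat.
    by apply: archi_boundP; rewrite invr_ge0 ltW.
  have n40 : 0 < n.+1%:R^-1 / 4 :> R by rewrite divr_gt0// invr_gt0.
  have [m [k0 cone]] := slope_cone (cantor_pt a) lcf n40.
  exists (n, m, k0); split => //= r r0.
  apply: contrapT => nz; apply: ne; apply/nbhs_ballP; exists r => //= z.
  rewrite -ball_normE/= => zr; rewrite ltNge; apply/negP => ze; apply: nz.
  by exists z => //; rewrite distrC (le_trans _ ze)// ltW.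
have [[[n m] k0] [a [N NP]]] := baire_cylinder Ecov.
set del : R := m.+1%:R^-1.
have del0 : 0 < del by rewrite invr_gt0.
have del1 : del <= 1 by rewrite invf_le1// ler1n.
have [N' NN' N'd] := exp4_small 1 N del0.
(* Digit k is free in the cylinder, 4^-k is below the length of the cone, and [slope k] lies within
   its aperture. *)
have [k N'k ksl] := slope_tail_dense N' (@slope_itv R k0) del0.
pose T : R := 4 ^- k.
have T0 : 0 < T by rewrite invr_gt0 exprn_gt0.
have Td : T < del.
  apply: le_lt_trans N'd; rewrite div1r lef_pV2 ?posrE ?exprn_gt0//.
  by rewrite ler_weXn2l// ler1n.
have T0d : 0 < T < del by rewrite T0.
have [rho rho0 rhoP] := cone_nbhs T0d del1 ksl (slope_norm k0).
have [M kM Mrho] := exp4_small 2 k.+1 rho0.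
(* Two sequences of the cylinder that differ in digit k alone. Density replaces them by members
   [c0], [c1] of E with the same first M digits: [c0] supplies the cone and [c1] the oscillation. *)
pose b0 l := (l < N)%N && a l; pose b1 l := (l == k) || b0 l.
have Nk : (N <= k)%N by exact: leq_trans N'k.
have ab0 l : (l < N)%N -> a l = b0 l by rewrite /b0 => ->.
have ab1 l : (l < N)%N -> a l = b1 l.
  by move=> lN; rewrite /b1 -ab0// ltn_eqF// (leq_trans lN).
have [c0 bc0 [_ cone]] := NP b0 M ab0.
have [c1 bc1 [osc _]] := NP b1 M ab1.
have step : `|cantor_pt c1 - cantor_pt c0 - pt T (slope k * T)| <= 2 / 4 ^+ M.
  apply: cantor_pt_step => //.
  - by rewrite -bc1// /b1 eqxx.
  - by rewrite -bc0// /b0 ltnNge Nk.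
  - by move=> l lM lk; rewrite -bc1// -bc0// /b1 (negbTE lk).
(* The tail 2/4^M and the distance from z to the point of [c1] are both below rho, so z lies in the
   cone at the point of [c0]. *)
have near z : `|cantor_pt c1 - z| < rho ->
    `|f z - f (cantor_pt c0)| <= n.+1%:R^-1 / 4.
  move=> zr; have [|t [s [td sd zE]]] := rhoP (z - cantor_pt c0).
    have -> : z - cantor_pt c0 - pt T (slope k * T) =
        (cantor_pt c1 - cantor_pt c0 - pt T (slope k * T)) - (cantor_pt c1 - z).
      by move: (pt _ _) => u; apply/rowP => i; rewrite !mxE; ring.
    apply: (le_lt_trans (ler_normB _ _)); lra.
  by have := cone s t sd td; rewrite -zE subrKC.
(* Both z and the point of [c1] have values within e/4 of that at [c0], where e = 1/(n+1), yet these
   values differ by at least e. *)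
have [z zr] := osc rho rho0.
have := near z zr; have := near (cantor_pt c1).
rewrite subrr normr0 => /(_ rho0).
have n0 : 0 < n.+1%:R^-1 :> R by rewrite invr_gt0.
have := ler_distD (f (cantor_pt c0)) (f z) (f (cantor_pt c1)).
rewrite /= [X in _ <= _ + X]distrC; move: n0; move: (n.+1%:R^-1) => e; lra.
Qed.

End not_discontinuity_set.

Unset Implicit Arguments.

Theorem proposition4p1 (R : realType) :
  exists (M : set 'rV[R]_2) (B : nat -> set 'rV[R]_2),
    [/\ M = \bigcup_k B k,
        forall k,
          [/\ compact (B k) /\
                (exists L : set 'rV[R]_2,
                   lipschitz_hypersurface L /\ B k `<=` L),
              forall a v : 'rV[R]_2, v != 0 ->
                nowhere_dense_in (line a v) (orth_proj a v @` B k) &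
              forall c : 'rV[R]_2, ~ B k c ->
                nowhere_dense_in (@unit_sphere R) (direction c @` B k)] &
        ~ Dl2 M].
Proof.
exists (range cantor_pt), (fun=> range cantor_pt); split.
- by rewrite bigcup_const//; exists 0%N.
- move=> _; split.
  + by split; [exact: compact_cantor | exact: cantor_lipschitz_hypersurface].
  + by move=> a v; exact: nowhere_dense_orth_proj.
  + by move=> c; exact: nowhere_dense_direction.
- by move=> [f lcf]; exact: discontinuity_set_neq_cantor.
Qed.
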